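(* Let $A$ be an associative unital Banach ring. Then the non-commutative analytic spectrum of $A$ is non-empty: $M_{NC}(A)\neq\emptyset$.
   Context: An associative unital Banach ring $A$ is a (not necessarily commutative) unital ring complete with respect to a norm $|\cdot|_A$ which satisfies $|a+b|_A\le |a|_A+|b|_A$, is submultiplicative ($|ab|_A\le |a|_A|b|_A$) and satisfies $|1|_A=1$. A seminormed $A$-module is a left unital $A$-module $M$ with a seminorm $|\cdot|$ such that for some $C>0$ one has $|am|\le C|a|_A|m|$ for all $a\in A$, $m\in M$. Seminormed $A$-modules form a category $A\text{-mod}^c$ whose morphisms are bounded homomorphisms of $A$-modules ($|f(m)|\le \mathrm{const}\cdot|m|$). A morphism $f:M\to N$ is admissible if the quotient seminorm on $\mathrm{Im}(f)\simeq M/\mathrm{Ker}(f)$ is equivalent to the seminorm induced from $N$. $A\text{-mod}^b$ is the full subcategory of $A\text{-mod}^c$ of modules complete with respect to their seminorms. $A\text{-mod}$ is the category of all left unital $A$-modules. For objects of $A\text{-mod}^c$ write $N\ge_c M$ if there exist a finite direct sum $\oplus_I N$ of copies of $N$, a closed admissible embedding $L\to\oplus_I N$ and an admissible epimorphism (surjection) $L\to M$. For objects of $A\text{-mod}$ write $N\ge M$ if there exist a submodule $L$ of a finite direct sum of copies of $N$ and a surjection $L\to M$. Let $=_c$ (resp. $=$) be the equivalence relation associated with the preorder $\ge_c$ (resp. $\ge$), i.e. $M=_cN$ iff $M\ge_cN$ and $N\ge_cM$, and similarly for $=$. An object $M$ of $A\text{-mod}^c$ (resp. $A\text{-mod}$)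 is minimal if: 1) for every closed admissible embedding (resp. every embedding) $N\to M$ with $N\ne 0$ one has $N\ge_c M$ (resp. $N\ge M$); 2) there is $m\in M$ with $|m|\ne 0$ (resp. $m\neq 0$). $\mathrm{Spec}(A)$ is the set of $=$-equivalence classes of minimal objects of $A\text{-mod}$. $M_{NC}(A)$ is the set of $=_c$-equivalence classes of objects $M$ of $A\text{-mod}^b$ that are minimal (i.e. satisfy 1) and 2) in $A\text{-mod}^c$) and also satisfy: 3) for every $m_0\in M$ with $|m_0|\neq 0$ the left $A$-module $Am_0$ is a minimal object of $A\text{-mod}$, and the resulting point of $\mathrm{Spec}(A)$ does not depend on the choice of $m_0$. *)

(* Defs.v *)
From HB Require Import structures.
From mathcomp Require Import all_boot all_order all_algebra.
From mathcomp Require Import all_classical all_reals all_analysis.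

Set Implicit Arguments.
Unset Strict Implicit.
Unset Printing Implicit Defensive.

Import Order.TTheory GRing.Theory Num.Theory.
Import numFieldNormedType.Exports.

Local Open Scope classical_set_scope.
Local Open Scope ring_scope.

(* MathComp's normedZmodType cannot be used here: its axiom
   `|x *+ n| = `|x| *+ n excludes non-archimedean norms. *)
Record is_seminorm (R : realType) (V : zmodType) (p : V -> R) : Prop := {
  seminorm0 : p 0 = 0;
  seminorm_ge0 : forall x, 0 <= p x;
  seminormN : forall x, p (- x) = p x;
  seminormD : forall x y, p (x + y) <= p x + p y
}.

(* Limits need not be unique, since p x = 0 does not imply x = 0. *)
Definition seminorm_complete (R : realType) (V : zmodType) (p : V -> R) : Prop :=
  forall u : nat -> V,
    (forall e : R, 0 < e -> \forall m & n \near \oo, p (u m - u n) < e) ->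
    exists l : V, (p (u n - l) @[n --> \oo] --> (0 : R)).

Definition seminorm_closed (R : realType) (V : zmodType) (p : V -> R)
    (S : set V) : Prop :=
  forall y : V, (forall e : R, 0 < e -> exists2 x, S x & p (x - y) < e) -> S y.

Record banachRing (R : realType) := BanachRing {
  br_ring :> pzRingType;
  br_norm : br_ring -> R;
  br_seminorm : is_seminorm br_norm;
  br_norm_eq0 : forall a, br_norm a = 0 -> a = 0;
  br_normM : forall a b, br_norm (a * b) <= br_norm a * br_norm b;
  br_norm1 : br_norm 1 = 1;
  br_complete : seminorm_complete br_norm
}.

(* Equivalence classes of modules are predicates on a large type, on which
   MathComp-Analysis's set cannot be used for universe reasons; two classes
   are identified when they have the same members. *)
Definition same_class (T : Type) (x y : T -> Prop) : Prop :=
  forall t : T, x t <-> y t.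

Section AlgebraicSpectrum.
Variable A : pzRingType.

(* N >= M: M is a quotient of a submodule of a finite direct sum of copies
   of N, the submodule being given by the injection i. *)
Definition mod_ge (N M : lmodType A) : Prop :=
  exists (I : finType) (L : lmodType A)
         (i : {linear L -> {ffun I -> N}}) (q : {linear L -> M}),
    injective i /\ (forall m, exists l, q l = m).

Definition mod_eqv (M N : lmodType A) : Prop := mod_ge M N /\ mod_ge N M.

Definition mod_minimal (M : lmodType A) : Prop :=
  (forall (N : lmodType A) (i : {linear N -> M}),
     injective i -> (exists n : N, n <> 0) -> mod_ge N M) /\
  (exists m : M, m <> 0).

Definition mod_class (M : lmodType A) : lmodType A -> Prop :=
  fun N => mod_minimal N /\ mod_eqv N M.

Definition Spec (x : lmodType A -> Prop) : Prop :=
  exists2 M : lmodType A, mod_minimal M & same_class x (mod_class M).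

End AlgebraicSpectrum.

Section CyclicSubmodule.
Variables (A : pzRingType) (M : lmodType A) (m0 : M).

Definition cyclic_pred : {pred M} := fun m => `[< exists a : A, m = a *: m0 >].

Lemma cyclic_submod_closed : submod_closed cyclic_pred.
Proof.
split; first by apply/asboolP; exists 0; rewrite scale0r.
move=> c u v /asboolP[a ->] /asboolP[b ->]; apply/asboolP.
by exists (c * a + b); rewrite scalerDl scalerA.
Qed.

HB.instance Definition _ :=
  GRing.isSubmodClosed.Build A M cyclic_pred cyclic_submod_closed.

Record cyclic_submod := CyclicSubmod {
  cyclic_val :> M;
  cyclic_valP : cyclic_val \in cyclic_pred
}.

HB.instance Definition _ := [isSub for cyclic_val].
HB.instance Definition _ := [Choice of cyclic_submod by <:].
HB.instance Definition _ := [SubChoice_isSubLmodule of cyclic_submod by <:].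

End CyclicSubmodule.

Section AnalyticSpectrum.
Variables (R : realType) (A : banachRing R).

Record snmod := SNMod {
  sn_mod :> lmodType A;
  snorm : sn_mod -> R;
  snorm_seminorm : is_seminorm snorm;
  snormZ : exists2 C : R, 0 < C &
    forall (a : A) (m : sn_mod), snorm (a *: m) <= C * br_norm a * snorm m
}.

Section DirectSum.
Variables (I : finType) (N : snmod).

(* The sum of the seminorms of the components; the maximum would give an
   equivalent seminorm. *)
Definition dsum_norm (f : {ffun I -> N}) : R := \sum_(i : I) snorm (f i).

Lemma dsum_seminorm : is_seminorm dsum_norm.
Proof.
have [p0 p_ge0 pN pD] := snorm_seminorm N.
split=> [|f|f|f g]; rewrite /dsum_norm.
- by apply: big1 => i _; rewrite ffunE p0.
- exact: sumr_ge0.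
- by apply: eq_bigr => i _; rewrite ffunE pN.
- by rewrite -big_split /=; apply: ler_sum => i _; rewrite ffunE.
Qed.

Lemma dsum_normZ : exists2 C : R, 0 < C &
  forall (a : A) (f : {ffun I -> N}),
    dsum_norm (a *: f) <= C * br_norm a * dsum_norm f.
Proof.
have [C C0 CP] := snormZ N; exists C => // a f.
by rewrite /dsum_norm mulr_sumr; apply: ler_sum => i _; rewrite ffunE.
Qed.

Definition dsum : snmod := SNMod dsum_seminorm dsum_normZ.

End DirectSum.

Definition bounded_hom (M N : snmod) (f : {linear M -> N}) : Prop :=
  exists C : R, forall m : M, snorm (f m) <= C * snorm m.

(* The fibre of f over y = f x is the coset x + Ker f, so on Im f this is the
   quotient seminorm of M / Ker f; outside Im f its value is irrelevant. *)
Definition quotient_norm (M N : snmod) (f : {linear M -> N}) (y : N) : R :=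
  inf [set snorm x | x in [set x : M | f x = y]].

Definition admissible (M N : snmod) (f : {linear M -> N}) : Prop :=
  bounded_hom f /\
  exists c C : R, [/\ 0 < c, 0 < C & forall y : N, range f y ->
    c * snorm y <= quotient_norm f y <= C * snorm y].

Definition closed_admissible_embedding (M N : snmod)
    (f : {linear M -> N}) : Prop :=
  [/\ admissible f, injective f & seminorm_closed (@snorm N) (range f)].

Definition admissible_epi (M N : snmod) (f : {linear M -> N}) : Prop :=
  admissible f /\ (forall y : N, exists x : M, f x = y).

Definition sn_ge (N M : snmod) : Prop :=
  exists (I : finType) (L : snmod)
         (i : {linear L -> dsum I N}) (q : {linear L -> M}),
    closed_admissible_embedding i /\ admissible_epi q.

Definition sn_eqv (M N : snmod) : Prop := sn_ge M N /\ sn_ge N M.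

Definition sn_minimal (M : snmod) : Prop :=
  (forall (N : snmod) (i : {linear N -> M}),
     closed_admissible_embedding i -> (exists n : N, n <> 0) -> sn_ge N M) /\
  (exists m : M, snorm m <> 0).

Definition cyclic_spec_constant (M : snmod) : Prop :=
  exists2 x : lmodType A -> Prop, Spec x &
    forall m0 : M, snorm m0 <> 0 ->
      mod_minimal (cyclic_submod m0) /\
      same_class x (mod_class (cyclic_submod m0)).

Definition NC_point (M : snmod) : Prop :=
  [/\ seminorm_complete (@snorm M), sn_minimal M & cyclic_spec_constant M].

Definition NC_class (M : snmod) : snmod -> Prop :=
  fun N => NC_point N /\ sn_eqv N M.

Definition M_NC (x : snmod -> Prop) : Prop :=
  exists2 M : snmod, NC_point M & same_class x (NC_class M).

End AnalyticSpectrum.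

(* Main.v *)
(* A proper left ideal stays at distance at least 1 from the unit, because any
   element a with |1 - a| < 1 is left invertible (Neumann series). Hence, for a
   maximal left ideal J, the quotient seminorm on the simple module A / J is
   complete and nonzero. A simple module is minimal for both preorders, and all
   its submodules A m0 with m0 <> 0 are the whole module, so A / J defines a
   point of the analytic spectrum. *)

Require Import Defs.
From HB Require Import structures.
From mathcomp Require Import all_boot all_order all_algebra.
From mathcomp Require Import all_classical all_reals all_analysis.

Set Implicit Arguments.
Unset Strict Implicit.
Unset Printing Implicit Defensive.

Import Order.TTheory GRing.Theory Num.Theory.
Import numFieldNormedType.Exports.

Local Open Scope classical_set_scope.
Local Open Scope ring_scope.

(** * Cauchy sequences and geometric series for a seminorm *)

Section Seminorm.
Variables (R : realType) (V : zmodType) (p : V -> R).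
Hypothesis p_sn : is_seminorm p.

Lemma seminorm_cvg0P (u : nat -> V) :
  (p (u n) @[n --> \oo] --> (0 : R)) <->
  forall e, 0 < e -> exists N, forall n, (N <= n)%N -> p (u n) < e.
Proof.
split=> [/cvgr0Pnorm_lt u0 e e0|u0].
  have [N _ NP] := u0 e e0; exists N => n /NP /=.
  by rewrite ger0_norm // seminorm_ge0.
apply/cvgr0Pnorm_lt => e e0; have [N NP] := u0 e e0.
by exists N => // n /NP /=; rewrite ger0_norm // seminorm_ge0.
Qed.

Lemma seminorm_cauchyP (u : nat -> V) (e : R) :
  (\forall m & n \near \oo, p (u m - u n) < e) <->
  exists N, forall m n, (N <= m)%N -> (N <= n)%N -> p (u m - u n) < e.
Proof.
split=> [[[/= U U'] [/= [N1 _ N1U] [N2 _ N2U]] UP]|[N NP]].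
  exists (maxn N1 N2) => m n; rewrite !geq_max => /andP[m1 _] /andP[_ n2].
  by apply: (UP (m, n)); split; [exact: N1U|exact: N2U].
exists ([set m | (N <= m)%N], [set n | (N <= n)%N]); first by split; exists N.
by move=> [m n] [/= ? ?]; exact: NP.
Qed.

Lemma seminormBC x y : p (x - y) = p (y - x).
Proof. by rewrite -opprB seminormN. Qed.

Lemma seminorm_triangle y x z : p (x - z) <= p (x - y) + p (y - z).
Proof. by rewrite -[x - z](subrKA y) seminormD. Qed.

(** With K = C / (1 - r), the bound C r^k equals K (r^k - r^(k+1)), so the bounds on a tail
    telescope and the partial sums are Cauchy. *)
Lemma seminorm_complete_geometric (v : nat -> V) (C r : R) :
    seminorm_complete p -> 0 <= r < 1 ->
    (forall k, p (v k) <= C * r ^+ k) ->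
  exists l, p (\sum_(k < n) v k - l) @[n --> \oo] --> (0 : R).
Proof.
move=> p_compl /andP[r0 r1] vC; apply: p_compl => e e0.
set K := C / (1 - r).
have r1_gt0 : 0 < 1 - r by rewrite subr_gt0.
have C0 : 0 <= C.
  by have := le_trans (seminorm_ge0 p_sn (v 0)) (vC 0); rewrite mulr1.
have K0 : 0 <= K by rewrite divr_ge0 // ltW.
have tail m d :
    p (\sum_(k < m + d) v k - \sum_(k < m) v k) <= K * (r ^+ m - r ^+ (m + d)).
  elim: d => [|d IHd]; first by rewrite addn0 !subrr mulr0 seminorm0.
  rewrite addnS big_ord_recr /= addrAC.
  apply: le_trans (seminormD p_sn _ _) _.
  apply: le_trans (lerD IHd (vC _)) _.
  rewrite le_eqVlt; apply/orP; left; apply/eqP.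
  have -> : C = K * (1 - r) by rewrite divfK // gt_eqF.
  by rewrite -mulrA -mulrDr mulrBl mul1r -exprS subrKA.
have /cvgr0Pnorm_lt/(_ e e0)[N _ NP] : K * r ^+ n @[n --> \oo] --> (0 : R).
  rewrite -[X in _ --> X](mulr0 K); apply: cvgMr.
  by apply: cvg_expr; rewrite ger0_norm.
have tail_lt m n : (N <= m)%N -> (m <= n)%N ->
    p (\sum_(k < n) v k - \sum_(k < m) v k) < e.
  move=> Nm /subnKC <-; apply: le_lt_trans (tail _ _) _.
  have := NP m Nm; rewrite /= ger0_norm; last by rewrite mulr_ge0 ?exprn_ge0.
  by apply: le_lt_trans; rewrite ler_wpM2l // gerBl exprn_ge0.
apply/seminorm_cauchyP; exists N => m n Nm Nn; have [mn|/ltnW nm] := leqP m n.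
  by rewrite seminormBC tail_lt.
exact: tail_lt.
Qed.

End Seminorm.

(** * Quotient seminorms and their completeness *)

Section QuotientSeminorm.
Variables (R : realType) (V W : zmodType) (p : V -> R) (f : {additive V -> W}).
Hypotheses (p_sn : is_seminorm p) (f_surj : forall y, exists x, f x = y).

(** Same infimum as [quotient_norm], stated for an additive map so that it can equip a target that
    has no seminorm yet. Surjectivity keeps the fibres nonempty, away from the default value of
    [inf]. *)
Definition quot_seminorm (y : W) : R :=
  inf [set p x | x in [set x | f x = y]].

Lemma quot_seminorm_has_inf y : has_inf [set p x | x in [set x | f x = y]].
Proof.
split; first by have [x fx] := f_surj y; exists (p x); exists x.
by exists 0 => _ [x _ <-]; exact: seminorm_ge0.
Qed.

Lemma quot_seminorm_le x : quot_seminorm (f x) <= p x.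
Proof. by apply: ge_inf; [exact: (quot_seminorm_has_inf _).2|exists x]. Qed.

Lemma quot_seminorm_lift y e : 0 < e ->
  exists2 x, f x = y & p x < quot_seminorm y + e.
Proof.
move=> e0; have [_ [x fx <-] px] := inf_adherent e0 (quot_seminorm_has_inf y).
by exists x.
Qed.

Lemma quot_seminorm_ge0 y : 0 <= quot_seminorm y.
Proof.
apply: lb_le_inf; first exact: (quot_seminorm_has_inf y).1.
by move=> _ [x _ <-]; exact: seminorm_ge0.
Qed.

Lemma quot_seminorm_is_seminorm : is_seminorm quot_seminorm.
Proof.
have qN x : quot_seminorm (- x) <= quot_seminorm x.
  apply/ler_addgt0Pr => e e0; have [v <- /ltW pv] := quot_seminorm_lift x e0.
  apply: le_trans pv; rewrite -raddfN -(seminormN p_sn); exact: quot_seminorm_le.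
split=> [|x|x|x y].
- apply/le_anti; rewrite quot_seminorm_ge0 andbT -(raddf0 f).
  by apply: le_trans (quot_seminorm_le 0) _; rewrite (seminorm0 p_sn).
- exact: quot_seminorm_ge0.
- by apply/le_anti; rewrite qN -{1}[x]opprK qN.
- apply/ler_addgt0Pr => e e0; have e2 : 0 < e / 2 by rewrite divr_gt0.
  have [v <- /ltW pv] := quot_seminorm_lift x e2.
  have [w <- /ltW pw] := quot_seminorm_lift y e2.
  rewrite -raddfD; apply: le_trans (quot_seminorm_le _) _.
  apply: le_trans (seminormD p_sn _ _) _.
  by apply: le_trans (lerD pv pw) _; rewrite addrACA -splitr.
Qed.

(* A subsequence of a Cauchy sequence has increments of norm at most 2^-k;
   lifting these increments gives a convergent series in V whose image
   converges to the same limit. *)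
Lemma quot_seminorm_complete :
  seminorm_complete p -> seminorm_complete quot_seminorm.
Proof.
move=> p_compl u u_cauchy; pose h : R := 2^-1.
have h0 : 0 < h by rewrite invr_gt0.
have h1 : h < 1 by rewrite invf_lt1 // ltr1n.
have hk0 k : 0 < h ^+ k by rewrite exprn_gt0.
have /choice[N NP] k : exists N, forall m n, (N <= m)%N -> (N <= n)%N ->
    quot_seminorm (u m - u n) < h ^+ k.
  exact/seminorm_cauchyP/u_cauchy.
(* The running maximum makes the indices nondecreasing and keeps [s k] beyond the Cauchy threshold
   [N k]. *)
pose fix s k := if k is k'.+1 then maxn (N k'.+1) (s k') else N 0.
have Ns k : (N k <= s k)%N by case: k => //= k; rewrite leq_maxl.
have sS k : (s k <= s k.+1)%N by rewrite /= leq_maxr.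
(* One h^k bounds the quotient seminorm of the increment; the other is the slack allowed to the
   lift. *)
have /choice[v vP] k :
    exists x, f x = u (s k.+1) - u (s k) /\ p x <= 2 * h ^+ k.
  have [x fx px] := quot_seminorm_lift (u (s k.+1) - u (s k)) (hk0 k).
  exists x; split=> //; apply: le_trans (ltW px) _.
  rewrite mulr_natl mulr2n lerD2r ltW // NP //.
  exact: leq_trans (Ns k) (sS k).
(* Starting from a lift of [u (s 0)], the partial sums lift the subsequence exactly. *)
have [v0 fv0] := f_surj (u (s 0)).
have h01 : 0 <= h < 1 by rewrite ltW.
have [l /(seminorm_cvg0P p_sn) lP] :=
  seminorm_complete_geometric p_sn p_compl h01 (fun k => (vP k).2).
have fsum n : f (v0 + \sum_(k < n) v k) = u (s n).
  elim: n => [|n IHn]; first by rewrite big_ord0 addr0.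
  by rewrite big_ord_recr /= addrA raddfD IHn (vP n).1 addrC subrK.
exists (f (v0 + l)); apply/(seminorm_cvg0P quot_seminorm_is_seminorm) => e e0.
have e2 : 0 < e / 2 by rewrite divr_gt0.
have [N1 N1P] := lP _ e2.
have /cvgr0Pnorm_lt/(_ _ e2)[N2 _ N2P] : h ^+ n @[n --> \oo] --> (0 : R).
  by apply: cvg_expr; rewrite gtr0_norm.
(* [N2] brings h^k, hence the distance from [u n] to [u (s k)], below e/2; [N1] does the same for
   the distance from [u (s k)] to the limit. *)
pose k := maxn N1 N2; exists (N k) => n Nn.
apply: le_lt_trans
  (seminorm_triangle quot_seminorm_is_seminorm (u (s k)) _ _) _.
rewrite [ltRHS]splitr; apply: ltrD.
  apply: lt_trans (NP k _ _ Nn (Ns k)) _.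
  by have := N2P k (leq_maxr _ _); rewrite /= gtr0_norm.
rewrite -fsum -raddfB; apply: le_lt_trans (quot_seminorm_le _) _.
by rewrite opprD addrACA subrr add0r N1P // leq_maxl.
Qed.

End QuotientSeminorm.

(** * Left inverses and maximal left ideals *)

(** With c = 1 - a, the partial sums s_n of the powers of c satisfy s_n a = 1 - c^n. If l is their
    limit, |l a - 1| lies below a sequence tending to 0, and the norm is definite. *)
Lemma banach_left_inverse (R : realType) (A : banachRing R) (a : A) :
  br_norm (1 - a) < 1 -> exists b : A, b * a = 1.
Proof.
have p_sn := br_seminorm A; set c := 1 - a => c1.
have cX k : br_norm (c ^+ k) <= 1 * br_norm c ^+ k.
  elim: k => [|k IHk]; first by rewrite !expr0 br_norm1 mulr1.
  rewrite !exprS mul1r; apply: le_trans (br_normM _ _) _.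
  by rewrite ler_wpM2l ?seminorm_ge0 // -[leRHS]mul1r.
have c01 : 0 <= br_norm c < 1 by rewrite seminorm_ge0.
have [l lP] := seminorm_complete_geometric p_sn (@br_complete _ A) c01 cX.
exists l; apply/eqP; rewrite -subr_eq0; apply/eqP/br_norm_eq0/le_anti.
rewrite seminorm_ge0 // andbT.
have sumM n : (\sum_(k < n) c ^+ k) * a = 1 - c ^+ n.
  elim: n => [|n IHn]; first by rewrite big_ord0 mul0r expr0 subrr.
  rewrite big_ord_recr /= mulrDl IHn -[X in _ ^+ n * X](subKr 1) mulrBr mulr1.
  by rewrite -exprSr subrKA.
have dist_le n : br_norm (l * a - 1) <=
    br_norm (\sum_(k < n) c ^+ k - l) * br_norm a + br_norm c ^+ n.
  apply: le_trans (seminorm_triangle p_sn ((\sum_(k < n) c ^+ k) * a) _ _) _.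
  apply: lerD.
    by rewrite -mulrBl (seminormBC p_sn _ l); exact: br_normM.
  rewrite sumM addrAC subrr add0r seminormN //.
  by rewrite -[leRHS]mul1r.
have : br_norm (\sum_(k < n) c ^+ k - l) * br_norm a + br_norm c ^+ n
    @[n --> \oo] --> (0 : R).
  rewrite -[X in _ --> X]addr0; apply: cvgD.
    by rewrite -(mul0r (br_norm a)); apply: cvgMl.
  by apply: cvg_expr; rewrite ger0_norm ?seminorm_ge0.
move=> lim0; rewrite -(cvg_lim (@Rhausdorff R) lim0).
by apply: limr_ge; [apply/cvg_ex; exists 0|exact: nearW].
Qed.

(** Zorn's lemma on left ideals missing 1. The last clause is maximality in usable form: 1 lies in S
    + A x. *)
Lemma exists_maximal_left_ideal (A : pzRingType) : (1 : A) <> 0 ->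
  exists S : {pred A^o}, [/\ submod_closed S, 1 \notin S &
    forall x, x \notin S -> exists a : A, 1 - a * x \in S].
Proof.
move=> one_neq0.
(* [P] does not ask for 0, so the empty set, which is the union of the empty chain, satisfies it. *)
pose P (X : set A) := (forall a u v, X u -> X v -> X (a * u + v)) /\ ~ X 1.
have [F FP Ftot|X [[Xlin X1] Xmax]] := @Zorn_bigcup A P.
  split=> [a u v [X FX Xu] [Y FY Yv]|[X FX X1]]; last by case: (FP X FX).
  have [XY|YX] := Ftot X Y FX FY.
    by exists Y => //; apply: (FP Y FY).1 => //; exact: XY.
  by exists X => //; apply: (FP X FX).1 => //; exact: YX.
(* Maximality recovers 0: an empty [X] would be strictly contained in {0}, which satisfies [P]
   because 1 is nonzero. *)
have X0 : X 0.
  have [[u Xu]|Xempty] := pselect (exists u, X u).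
    by have := Xlin (-1) _ _ Xu Xu; rewrite mulN1r addNr.
  exfalso; apply: (Xmax [set 0]); last first.
    by split=> // a u v /= -> ->; rewrite mulr0 addr0.
  split=> [u Xu|X0]; first by case: Xempty; exists u.
  by apply: Xempty; exists 0; exact: X0.
exists (fun u => `[< X u >]); split.
- split; first exact/asboolP.
  by move=> a u v /asboolP Xu /asboolP Xv; apply/asboolP/Xlin.
- exact/asboolP.
move=> x /asboolP Xx.
(* [B] is X + A x, strictly larger than [X] since it contains x; by maximality it must contain 1. *)
pose B : set A := [set y | exists a, X (y - a * x)].
have [[a Ba]|B1] := pselect (B 1); first by exists a; exact/asboolP.
exfalso; apply: (Xmax B); last first.
  split=> // a u v [b Xb] [c Xc]; exists (a * b + c).
  by rewrite mulrDl opprD addrACA -mulrA -mulrBr; exact: Xlin.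
split=> [u Xu|BX]; first by exists 0; rewrite mul0r subr0.
by apply/Xx/BX; exists 1; rewrite mul1r subrr.
Qed.

(** * Quotients of modules by submodules *)

Section SubmodQuotient.
Import Quotient.
Local Open Scope quotient_scope.
Variables (A : pzRingType) (M : lmodType A) (S : zmodClosed M).
Hypothesis S_scale : forall a x, x \in S -> a *: x \in S.
Local Notation Q := (@quot M S).

(** Scalars act on the additive quotient through chosen representatives; stability of [S] under
    scalars makes the choice irrelevant. *)
Definition quot_scale (a : A) (y : Q) : Q := \pi_Q (a *: repr y).

Lemma quot_scale_pi a x : quot_scale a (\pi_Q x) = \pi_Q (a *: x).
Proof.
apply/eqP; rewrite -idealrBE -scalerBr S_scale //.
by rewrite idealrBE reprK.
Qed.

Lemma quot_scaleA a b y : quot_scale a (quot_scale b y) = quot_scale (a * b) y.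
Proof. by rewrite -[y]reprK (quot_scale_pi b) !quot_scale_pi scalerA. Qed.

Lemma quot_scale1 : left_id 1 quot_scale.
Proof. by move=> y; rewrite -[y]reprK quot_scale_pi scale1r. Qed.

Lemma quot_scaleDr : right_distributive quot_scale +%R.
Proof.
move=> a y z; rewrite -[y]reprK -[z]reprK -raddfD !quot_scale_pi.
by rewrite scalerDr raddfD.
Qed.

Lemma quot_scaleDl y : {morph quot_scale^~ y : a b / a + b}.
Proof. by move=> a b; rewrite -[y]reprK !quot_scale_pi scalerDl raddfD. Qed.

Lemma zmod_quotient_linear : exists (L : lmodType A) (f : {linear M -> L}),
  (forall y, exists x, f x = y) /\ (forall x, f x = 0 <-> x \in S).
Proof.
pose L : lmodType A := HB.pack Q (GRing.Zmodule_isLmodule.Build A Q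
  quot_scaleA quot_scale1 quot_scaleDr quot_scaleDl).
pose g : M -> L := \pi_Q.
have g_lin : linear g.
  move=> a u v; rewrite /g raddfD; congr (_ + _).
  exact/esym/quot_scale_pi.
pose f : {linear M -> L} := HB.pack g (GRing.isLinear.Build A M L *:%R g g_lin).
exists L, f; split=> [y|x]; first by exists (repr y); exact: reprK.
rewrite -[x in x \in _]subr0 idealrBE raddf0.
by split=> [x0|/eqP //]; apply/eqP.
Qed.

End SubmodQuotient.

Lemma submod_quotient (A : pzRingType) (M : lmodType A) (S : {pred M}) :
    submod_closed S ->
  exists (Q : lmodType A) (f : {linear M -> Q}),
    (forall y, exists x, f x = y) /\ (forall x, f x = 0 <-> x \in S).
Proof.
move=> S_closed; have [S0 S_lin] := S_closed.
pose S' : zmodClosed M := HB.pack S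
  (GRing.isZmodClosed.Build M S (GRing.submod_closedB S_closed)).
apply: (zmod_quotient_linear (S := S')) => a x xS.
by rewrite -[a *: x]addr0; exact: S_lin.
Qed.

(** * Linear maps between finite powers *)

Section Diagonal.
Variables (A : pzRingType) (I : finType) (N : lmodType A).

(** Taken at ['I_1], this identifies a module with the direct sum of one copy of itself. *)
Definition ffun_diag (n : N) : {ffun I -> N} := [ffun=> n].

Lemma ffun_diag_linear : linear ffun_diag.
Proof. by move=> a u v; apply/ffunP => i; rewrite !ffunE. Qed.

HB.instance Definition _ :=
  GRing.isLinear.Build A N {ffun I -> N} *:%R ffun_diag ffun_diag_linear.

End Diagonal.

Section FfunMap.
Variables (A : pzRingType) (I : finType) (N N' : lmodType A).
Variable f : {linear N -> N'}.

Definition ffun_map (u : {ffun I -> N}) : {ffun I -> N'} := [ffun i => f (u i)].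

Lemma ffun_map_linear : linear ffun_map.
Proof. by move=> a u v; apply/ffunP => i; rewrite !ffunE linearP. Qed.

HB.instance Definition _ := GRing.isLinear.Build A {ffun I -> N} {ffun I -> N'}
  *:%R ffun_map ffun_map_linear.

Lemma ffun_map_inj : injective f -> injective ffun_map.
Proof.
move=> f_inj u v /ffunP uv; apply/ffunP => i; apply: f_inj.
by have := uv i; rewrite !ffunE.
Qed.

End FfunMap.

(** * Simple modules and the algebraic preorder *)

Section AlgebraicModules.
Variable A : pzRingType.

(** Generation by each nonzero element is the elementwise form of having no proper nonzero
    submodule. *)
Definition simple_mod (M : lmodType A) : Prop :=
  (exists m : M, m <> 0) /\
  forall m m' : M, m <> 0 -> exists a : A, m' = a *: m.

(** The image contains a nonzero element, and that element generates [M]. *)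
Lemma simple_linear_surj (M N : lmodType A) (i : {linear N -> M}) :
    simple_mod M -> injective i -> (exists n : N, n <> 0) ->
  forall m, exists n, i n = m.
Proof.
move=> [_ M_simple] i_inj [n n0] m; have [a ->] : exists a, m = a *: i n.
  by apply: M_simple => in0; apply/n0/i_inj; rewrite in0 raddf0.
by exists (a *: n); rewrite linearZ.
Qed.

Lemma mod_ge_surj (N M : lmodType A) (f : {linear N -> M}) :
  (forall m, exists n, f n = m) -> mod_ge N M.
Proof.
move=> f_surj; exists 'I_1, N, (@ffun_diag A 'I_1 N), f; split=> //.
by move=> u v /ffunP/(_ ord0); rewrite !ffunE.
Qed.

Lemma simple_mod_minimal (M : lmodType A) : simple_mod M -> mod_minimal M.
Proof.
move=> M_simple; split; last exact: M_simple.1.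
by move=> N i i_inj N0; apply: (mod_ge_surj (f := i)); exact: simple_linear_surj.
Qed.

Lemma mod_ge_inj_l (N N' M : lmodType A) (f : {linear N -> N'}) :
  injective f -> mod_ge N M -> mod_ge N' M.
Proof.
move=> f_inj [I [L [i [q [i_inj q_surj]]]]].
exists I, L, (@ffun_map A I N N' f \o i), q; split=> //.
exact: inj_comp (ffun_map_inj f_inj) i_inj.
Qed.

Lemma mod_ge_surj_r (N M M' : lmodType A) (f : {linear M -> M'}) :
  (forall m', exists m, f m = m') -> mod_ge N M -> mod_ge N M'.
Proof.
move=> f_surj [I [L [i [q [i_inj q_surj]]]]].
exists I, L, i, (f \o q); split=> // m'.
by have [m <-] := f_surj m'; have [l <-] := q_surj m; exists l.
Qed.

Lemma linear_inverse (M M' : lmodType A) (f : {linear M -> M'}) :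
    injective f -> (forall m', exists m, f m = m') ->
  exists g : {linear M' -> M}, cancel f g /\ cancel g f.
Proof.
move=> f_inj /choice[g gK].
have g_lin : linear g by move=> a u v; apply: f_inj; rewrite linearP !gK.
pose G : {linear M' -> M} := HB.pack g (GRing.isLinear.Build A M' M *:%R g g_lin).
by exists G; split=> // m; apply: f_inj; rewrite gK.
Qed.

(** [mod_ge] is carried along an injection in its first argument and along a surjection in its
    second; [f] and its inverse are both at once, which gives the two directions. *)
Lemma mod_class_iso (M M' : lmodType A) (f : {linear M -> M'}) :
    injective f -> (forall m', exists m, f m = m') ->
  same_class (mod_class M) (mod_class M').
Proof.
move=> f_inj f_surj N; have [g [fK gK]] := linear_inverse f_inj f_surj.
have g_inj := can_inj gK; have g_surj m : exists m', g m' = m by exists (f m).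
split=> [[N_min [NM MN]]|[N_min [NM MN]]]; split=> //; split.
- exact: mod_ge_surj_r f_surj NM.
- exact: mod_ge_inj_l f_inj MN.
- exact: mod_ge_surj_r g_surj NM.
- exact: mod_ge_inj_l g_inj MN.
Qed.

Lemma cyclic_simple (M : lmodType A) (m0 : M) :
  simple_mod M -> m0 <> 0 -> simple_mod (cyclic_submod m0).
Proof.
move=> [_ M_simple] m0_neq0.
have m0P : m0 \in cyclic_pred m0 by apply/asboolP; exists 1; rewrite scale1r.
split; first by exists (CyclicSubmod m0P) => /(congr1 (@cyclic_val _ _ _)).
move=> m m' m_neq0; have [|a am] := M_simple (val m) (val m').
  by move=> vm0; apply/m_neq0/val_inj; rewrite vm0.
by exists a; apply: val_inj; rewrite am.
Qed.

(** By simplicity the inclusion of A m0 into [M] is an isomorphism. *)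
Lemma cyclic_class (M : lmodType A) (m0 : M) : simple_mod M -> m0 <> 0 ->
  same_class (mod_class M) (mod_class (cyclic_submod m0)).
Proof.
move=> M_simple m0_neq0 N.
have v_inj : injective (val : cyclic_submod m0 -> M) by exact: val_inj.
have C0 := (cyclic_simple M_simple m0_neq0).1.
have [H1 H2] := mod_class_iso v_inj (simple_linear_surj M_simple v_inj C0) N.
by split.
Qed.

End AlgebraicModules.

(** * Simple seminormed modules and quotient modules *)

Section SeminormedModules.
Variables (R : realType) (A : banachRing R).

Lemma quotient_norm_inj (M N : snmod A) (f : {linear M -> N}) (x : M) :
  injective f -> quotient_norm f (f x) = snorm x.
Proof.
move=> f_inj; rewrite /quotient_norm.
have -> : [set x' : M | f x' = f x] = [set x].
  by apply/seteqP; split=> [x' /= /f_inj|x' /= ->].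
by rewrite image_set1 inf1.
Qed.

(** By simplicity a closed admissible embedding of a nonzero [N] into [M] is onto, so it is itself
    the admissible epimorphism required, with L = N and one copy of [N]. *)
Lemma simple_sn_minimal (M : snmod A) :
  simple_mod M -> (exists m : M, snorm m <> 0) -> sn_minimal M.
Proof.
move=> M_simple M0; split=> // N i i_emb N0.
pose d : {linear N -> dsum 'I_1 N} := @ffun_diag A 'I_1 N.
have d_norm n : snorm (d n) = snorm n by rewrite /= /dsum_norm big_ord1 ffunE.
have d_inj : injective d by move=> u v /ffunP/(_ ord0); rewrite !ffunE.
(* The diagonal into one copy is onto, so its range is closed. *)
have d_surj u : range d u.
  by exists (u ord0) => //; apply/ffunP => j; rewrite ffunE [j]ord1.
exists 'I_1, N, d, i; split; first split=> //.
  split; first by exists 1 => n; rewrite d_norm mul1r.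
  exists 1, 1; split=> // y [n _ <-].
  by rewrite (quotient_norm_inj n d_inj) d_norm !mul1r lexx.
by case: i_emb => i_adm i_inj _; split=> //; exact: simple_linear_surj.
Qed.

Lemma simple_NC_point (M : snmod A) :
    seminorm_complete (@snorm _ _ M) -> simple_mod M ->
  (exists m : M, snorm m <> 0) -> NC_point M.
Proof.
move=> M_compl M_simple M0; split=> //; first exact: simple_sn_minimal.
exists (mod_class M); first by exists M => //; exact: simple_mod_minimal.
move=> m0 m0_norm; have m0_neq0 : m0 <> 0.
  by move=> m00; apply: m0_norm; rewrite m00 (seminorm0 (snorm_seminorm M)).
split; last exact: cyclic_class.
exact/simple_mod_minimal/cyclic_simple.
Qed.

Section QuotientModule.
Variables (M : snmod A) (Q : lmodType A) (f : {linear M -> Q}).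
Hypothesis f_surj : forall y, exists x, f x = y.

Lemma quot_seminormZ : exists2 C : R, 0 < C & forall (a : A) (y : Q),
  quot_seminorm (@snorm _ _ M) f (a *: y) <=
  C * br_norm a * quot_seminorm (@snorm _ _ M) f y.
Proof.
have [C C0 CP] := snormZ M; exists C => // a y; set K := C * br_norm a.
have K0 : 0 <= K by rewrite mulr_ge0 ?(ltW C0) ?(seminorm_ge0 (br_seminorm A)).
apply/ler_addgt0Pr => e e0.
(* The error of the lift gets multiplied by K, and K e / (K + 1) is at most e; adding 1 covers K =
   0. *)
have d0 : 0 < e / (K + 1) by rewrite divr_gt0 // ltr_wpDl.
have [x <- px] := quot_seminorm_lift (snorm_seminorm M) f_surj y d0.
rewrite -linearZ; apply: le_trans (quot_seminorm_le (snorm_seminorm M) f_surj _) _.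
apply: le_trans (CP a x) _; apply: le_trans (ler_wpM2l K0 (ltW px)) _.
rewrite mulrDr lerD2l mulrCA ler_piMr ?(ltW e0) // ler_pdivrMr ?mul1r.
  by rewrite lerDl.
by rewrite ltr_wpDl.
Qed.

Definition quot_snmod : snmod A :=
  SNMod (quot_seminorm_is_seminorm (snorm_seminorm M) f_surj) quot_seminormZ.

End QuotientModule.

Lemma regular_snormZ : exists2 C : R, 0 < C &
  forall (a : A) (m : A^o), br_norm (a *: m) <= C * br_norm a * br_norm m.
Proof. by exists 1 => // a m; rewrite mul1r; exact: br_normM. Qed.

Definition regular_snmod : snmod A :=
  @SNMod R A A^o (@br_norm R A) (br_seminorm A) regular_snormZ.

End SeminormedModules.

(** * The point given by a maximal left ideal *)

Theorem corollary1 (R : realType) (A : banachRing R) :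
  exists x : snmod A -> Prop, M_NC x.
Proof.
(* A [pzRingType] may be the zero ring; |1| = 1 excludes it. *)
have one_neq0 : (1 : A) <> 0.
  move=> A10; have := br_norm1 A; rewrite A10 (seminorm0 (br_seminorm A)).
  by move/esym/eqP; rewrite oner_eq0.
have [J [J_closed J1 J_max]] := exists_maximal_left_ideal one_neq0.
have [Q [f [f_surj f_ker]]] := submod_quotient J_closed.
pose M := quot_snmod (M := regular_snmod A) f_surj.
have f1_neq0 : f 1 <> 0 by move/f_ker; apply/negP.
exists (NC_class M), M => //; apply: simple_NC_point.
- exact: (quot_seminorm_complete (snorm_seminorm (regular_snmod A)) f_surj
    (@br_complete R A)).
- split; first by exists (f 1).
  move=> y z; have [x <-] := f_surj y; have [w <-] := f_surj z => fx0.
  have [|a aJ] := J_max x; first by apply/negP => /f_ker.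
  (* Multiplying 1 - a x in J by w on the left puts w - (w a) x in J, so f w = (w a) f x. *)
  exists (w * a); rewrite -linearZ; apply/eqP; rewrite -subr_eq0 -raddfB.
  apply/eqP/f_ker; have := J_closed.2 w _ 0 aJ J_closed.1.
  by rewrite addr0 scalerBr /GRing.scale /= mulr1 mulrA.
(* If f 1 had norm zero, J would contain an element at distance less than 1
   from 1, and such an element is left invertible. *)
exists (f 1) => f1_norm.
have [x fx x1] :=
  quot_seminorm_lift (snorm_seminorm (regular_snmod A)) f_surj (f 1) ltr01.
have [|b b1] := banach_left_inverse (a := 1 - x).
  by rewrite subKr; move: x1; rewrite [quot_seminorm _ _ _]f1_norm add0r.
apply: f1_neq0; rewrite -b1.
have -> : f (b * (1 - x)) = b *: f (1 - x) by rewrite -linearZ.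
by rewrite raddfB fx subrr scaler0.
Qed.
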